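(* Let $b,n,k\in\mathbb{N}$ with $b\ge2$. Then $$h_k^{(b)}(z_1,\ldots,z_n)=\sum_{|\lambda|=k}z_\lambda^{-1}(1-b)^{l_b(\lambda)}p_\lambda(z_1,\ldots,z_n),$$ and substituting $z_i=1$ for all $i$ gives $$\binom{n}{k}^{(b)}=\sum_{|\lambda|=k}z_\lambda^{-1}(1-b)^{l_b(\lambda)}n^{l(\lambda)},$$ where both sums are over all integer partitions $\lambda$ of $k$.
   Context: The $b$-bounded symmetric polynomials $h_k^{(b)}(z_1,\ldots,z_n)$ are defined by $\sum_{k\ge0}h_k^{(b)}(z_1,\ldots,z_n)t^k=\prod_{i=1}^n(1+z_it+(z_it)^2+\cdots+(z_it)^{b-1})$, and the integers $\binom{n}{k}^{(b)}$ by $\sum_k\binom{n}{k}^{(b)}t^k=(1+t+\cdots+t^{b-1})^n$. For an integer partition $\lambda=(\lambda_1\ge\lambda_2\ge\cdots)$: $|\lambda|=\sum_i\lambda_i$; $l(\lambda)$ is the number of nonzero parts; $l_b(\lambda)$ is the number of (nonzero) parts divisible by $b$; $m_i$ is the number of parts equal to $i$; $z_\lambda=\prod_{i\ge1}i^{m_i}\cdot m_i!$ (an integer unrelated to the variables $z_i$). The power sums are $p_k(z_1,\ldots,z_n)=z_1^k+\cdots+z_n^k$ for $k\geq 1$ and $p_\lambda=\prod_{i=1}^{l(\lambda)}p_{\lambda_i}$. *)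

(* Defs.v *)
From HB Require Import structures.
From mathcomp Require Import all_boot all_order all_algebra.
From mathcomp Require Import mpoly.

Set Implicit Arguments.
Unset Strict Implicit.
Unset Printing Implicit Defensive.

Import GRing.Theory.
Local Open Scope ring_scope.

(* The generating series is a polynomial in t, here 'X : {poly {mpoly R[n]}}. *)
Definition bsym (R : comNzRingType) (b n k : nat) : {mpoly R[n]} :=
  (\prod_(i < n) \sum_(j < b) (('X_i : {mpoly R[n]})%:P * 'X) ^+ j)`_k.

Definition bbinom (b n k : nat) : int :=
  ((\sum_(j < b) 'X^j : {poly int}) ^+ n)`_k.

Definition is_intpartn (k : nat) (la : seq nat) : bool :=
  [&& sorted geq la, 0%N \notin la & sumn la == k].

Record intpartn (k : nat) :=
  IntPartn { parts :> seq nat; _ : is_intpartn k parts }.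

HB.instance Definition _ k := [isSub for @parts k].
HB.instance Definition _ k := [Countable of intpartn k by <:].

(* A partition of k has at most k parts, each at most k, so that all of them
   occur in this list. *)
Definition enum_intpartn (k : nat) : seq (intpartn k) :=
  undup (pmap insub [seq map val (val la) | la : k.-bseq 'I_k.+1]).

Lemma enum_intpartnP k : Finite.axiom (enum_intpartn k).
Proof.
apply: Finite.uniq_enumP; first exact: undup_uniq.
move=> la; rewrite mem_undup mem_pmap_sub.
have /and3P[_ la0 /eqP sla] := valP la.
have lek : all (fun i => i < k.+1)%N (val la).
  by apply/allP => i ila; rewrite ltnS -sla sumnE (big_rem i ila) leq_addr.
have sz : (size (val la) <= k)%N.
  apply: leq_trans (_ : sumn (val la) <= _)%N; last by rewrite sla.
  elim: (val la) la0 => //= i s IH.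
  rewrite inE negb_or eq_sym -lt0n => /andP[i0 /IH].
  exact: (@leq_add 1).
have szi : (size (map (@inord k) (val la)) <= k)%N by rewrite size_map.
apply/mapP; exists (Bseq szi); first by rewrite mem_enum.
rewrite /= -map_comp -[LHS]map_id; apply/eq_in_map => i /(allP lek) ik.
by rewrite /= inordK.
Qed.

HB.instance Definition _ k := isFinite.Build (intpartn k) (@enum_intpartnP k).

Section Statistics.
Variable la : seq nat.

Definition part_mult (i : nat) : nat := count_mem i la.

(* The factors with i > sumn la are all 1. *)
Definition part_z : nat :=
  \prod_(1 <= i < (sumn la).+1) (i ^ part_mult i * (part_mult i)`!)%N.

(* An intpartn has no zero part, so its size is its number of nonzero parts. *)
Definition part_length : nat := size la.
Definition part_blength (b : nat) : nat := count (fun i => b %| i)%N la.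

End Statistics.

Definition psum (R : comNzRingType) (n k : nat) : {mpoly R[n]} :=
  \sum_(i < n) 'X_i ^+ k.

Definition psum_part (R : comNzRingType) (n : nat) (la : seq nat)
    : {mpoly R[n]} :=
  \prod_(i <- la) psum R n i.

(* Main.v *)
(* Let c_j be 1 - b if b divides j and 1 otherwise. The logarithmic derivative of
   F(t) = prod_i (1 - (z_i t)^b) / (1 - z_i t) is given by
   t F'(t) / F(t) = sum_(j >= 1) c_j p_j t^j, which amounts to the recurrence
   k h_k = sum_(1 <= j <= k) c_j p_j h_(k - j). The sums over the partitions of k
   of the products of the c_j p_j over the parts, weighted by 1 / z_lambda,
   satisfy the same recurrence. *)

Require Import Defs.
From mathcomp Require Import all_boot all_order all_algebra.
From mathcomp Require Import mpoly.

Set Implicit Arguments.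
Unset Strict Implicit.
Unset Printing Implicit Defensive.

Import GRing.Theory Num.Theory.
Local Open Scope ring_scope.

(** * Inserting a part into a partition and removing one *)

Lemma geq_trans : transitive geq.
Proof. by move=> y x z /= yx /leq_trans; apply. Qed.

Lemma geq_anti : antisymmetric geq.
Proof. by move=> x y; rewrite andbC => /anti_leq. Qed.

Lemma sort_geq_sorted s : sorted geq (sort geq s).
Proof. by apply: sort_sorted => x y; apply: leq_total. Qed.

Lemma intpartn_insert_subproof p m k (mu : intpartn m) :
  (0 < p)%N -> k = (p + m)%N -> is_intpartn k (sort geq (p :: mu)).
Proof.
case: mu => mu /= /and3P[_ mu0 /eqP smu] p0 ->; apply/and3P; split.
- exact: sort_geq_sorted.
- by rewrite mem_sort inE negb_or eq_sym -lt0n p0.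
- by rewrite (perm_sumn (permEl (perm_sort _ _))) /= smu.
Qed.

Lemma intpartn_remove_subproof p m k (la : intpartn k) :
  k = (p + m)%N -> p \in val la -> is_intpartn m (rem p la).
Proof.
case: la => la /= /and3P[sla la0 /eqP tla] kE pla; apply/and3P; split.
- exact: subseq_sorted geq_trans _ _ (rem_subseq _ _) sla.
- by apply: contra la0 => /mem_rem.
- have := perm_sumn (perm_to_rem pla).
  by rewrite /= tla kE => /addnI <-.
Qed.

(** Supplies a default element for [insubd]; for [m = 0] it is the empty partition. *)
Lemma intpartn_nseq1_subproof m : is_intpartn m (nseq m 1%N).
Proof.
apply/and3P; split.
- by elim: m => [|[|m] IH].
- by rewrite mem_nseq andbF.
- by rewrite sumn_nseq mul1n.
Qed.

(** Inserting [p] and removing one copy of [p] are mutually inverse. Invariance of [F] under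
    permutation allows [p :: mu] to stay unsorted on the right. *)
Lemma sum_intpartn_mem (V : nmodType) (F : seq nat -> V) p m k :
  (forall s t, perm_eq s t -> F s = F t) -> (0 < p)%N -> k = (p + m)%N ->
  \sum_(la : intpartn k | p \in val la) F la =
  \sum_(mu : intpartn m) F (p :: mu).
Proof.
move=> Fperm p0 kE.
pose h mu : intpartn k := IntPartn (intpartn_insert_subproof mu p0 kE).
pose h' (la : intpartn k) : intpartn m :=
  insubd (IntPartn (intpartn_nseq1_subproof m)) (rem p la).
rewrite (reindex_onto h h') => [|la pla]; last first.
  apply: val_inj; rewrite /= insubdK; last exact: (intpartn_remove_subproof kE).
  apply: (sorted_eq geq_trans geq_anti); first exact: sort_geq_sorted.
    by have /and3P[] := valP la.
  by rewrite perm_sort perm_sym perm_to_rem.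
apply: eq_big => [mu|mu _]; last by apply: Fperm; rewrite perm_sort.
rewrite /= mem_sort mem_head /=; apply/eqP/val_inj.
have ph : p \in val (h mu) by rewrite mem_sort mem_head.
have rP := intpartn_remove_subproof kE ph.
rewrite insubdK //; apply: (sorted_eq geq_trans geq_anti).
- by have /and3P[] := rP.
- by have /and3P[] := valP mu.
- by rewrite -(perm_cons p) -(permPl (perm_to_rem ph)) perm_sort.
Qed.

(** * Multiplicities and the integer z_lambda *)

Lemma sumn_part_mult s N : (sumn s <= N)%N ->
  sumn s = (\sum_(j < N) j.+1 * part_mult s j.+1)%N.
Proof.
move=> sN; rewrite sumnE.
under [RHS]eq_bigr do rewrite /part_mult -sum1_count big_distrr big_mkcond.
rewrite exchange_big /= !big_seq; apply: eq_bigr => -[|i] si.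
  by rewrite big1.
have iN : (i < N)%N.
  by apply: leq_trans sN; rewrite sumnE (big_rem _ si) leq_addr.
rewrite (bigD1 (Ordinal iN)) //= eqxx muln1 big1 ?addn0 // => j jN.
case: eqP => // -[ij]; case/eqP: jN; exact: val_inj.
Qed.

(** A common bound [N] lets the products for [s] and [p :: s] be compared factor by factor. *)
Lemma part_zE s N : (sumn s <= N)%N ->
  part_z s = (\prod_(1 <= i < N.+1) (i ^ part_mult s i * (part_mult s i)`!))%N.
Proof.
move=> sN; rewrite /part_z (big_cat_nat (n := (sumn s).+1) (p := N.+1)) //=.
rewrite [X in (_ * X)%N]big_nat_cond [X in (_ * X)%N]big1 ?muln1 // => i /andP[/andP[si _] _].
suff -> : part_mult s i = 0%N by [].
apply/count_memPn; apply: contraL si => si.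
by rewrite -leqNgt sumnE (big_rem _ si) leq_addr.
Qed.

Lemma part_z_perm s t : perm_eq s t -> part_z s = part_z t.
Proof.
move=> st; rewrite /part_z (perm_sumn st).
by apply: eq_bigr => i _; rewrite /part_mult (permP st).
Qed.

(** Only the factor at [p] changes: with m copies of [p] in [s], it goes from p^m m! to p^(m+1)
    (m+1)!. *)
Lemma part_z_cons p s : (0 < p)%N ->
  part_z (p :: s) = (p * part_mult (p :: s) p * part_z s)%N.
Proof.
move=> p0; have pN : (p < (p + sumn s).+1)%N by rewrite ltnS leq_addr.
rewrite (part_zE (N := p + sumn s) (s := p :: s)) //.
rewrite (part_zE (N := p + sumn s) (s := s)) ?leq_addl //.
rewrite !(big_rem p (r := index_iota _ _)) ?mem_index_iota ?p0 //=.
rewrite /part_mult /= eqxx add1n expnS factS [RHS]mulnA; congr (_ * _)%N.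
  by rewrite mulnACA.
rewrite !big_seq; apply: eq_bigr => i.
rewrite (mem_rem_uniq _ (iota_uniq _ _)) => /andP[/negPf ip _].
by rewrite eq_sym ip.
Qed.

(** * The weighted partition sums and their recurrence *)

Section Exponential.
Variables (K : numFieldType) (A : comAlgType K).
Implicit Types w h : nat -> A.

Definition partn_sum w k : A :=
  \sum_(la : intpartn k) (part_z la)%:R^-1 *: \prod_(i <- la) w i.

Lemma partn_sum0 w : partn_sum w 0 = 1.
Proof.
rewrite /partn_sum (big_pred1 (IntPartn (intpartn_nseq1_subproof 0))).
  by rewrite /= /part_z /= big_nil big_geq // invr1 scale1r.
move=> la; symmetry; apply/eqP/val_inj; have /and3P[_] := valP la.
by case: (val la) => [|[|i] s].
Qed.

(* Marking one of the parts p of the partition la multiplies 1 / z_la by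
   p * m_p, and p * m_p / z_la = 1 / z_mu where mu is la without that part. *)
Lemma partn_sum_rec w k :
  k%:R * partn_sum w k =
    \sum_(j < k) w j.+1 * partn_sum w (k - j.+1).
Proof.
rewrite /partn_sum mulr_sumr.
pose F (j : nat) (s : seq nat) : A :=
  ((j.+1 * part_mult s j.+1)%:R / (part_z s)%:R) *: \prod_(i <- s) w i.
(* The factor k is split as the sum of i * m_i over the possible part sizes i = j + 1. *)
transitivity (\sum_(j < k) \sum_(la : intpartn k) F j la).
  rewrite exchange_big; apply: eq_bigr => la _ /=.
  have /and3P[_ _ /eqP sla] := valP la.
  rewrite mulr_natl -scaler_nat scalerA /F -scaler_suml -mulr_suml -natr_sum.
  by rewrite -sumn_part_mult sla.
apply: eq_bigr => j _.
(* Partitions without the part j + 1 have multiplicity 0 there and contribute nothing. *)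
rewrite (bigID (fun la : intpartn k => j.+1 \in val la)) /= [X in _ + X]big1.
  rewrite addr0 (sum_intpartn_mem (m := k - j.+1)) ?subnKC //; last first.
    move=> s t st; rewrite /F /part_mult (permP st) (part_z_perm st).
    by rewrite (perm_big _ st).
  rewrite mulr_sumr; apply: eq_bigr => mu _.
  rewrite /F part_z_cons // big_cons -scalerAr [(_ * part_z _)%:R]natrM invfM.
  rewrite mulrA divff ?mul1r //.
  by rewrite pnatr_eq0 muln_eq0 /= /part_mult /= eqxx.
by move=> la /count_memPn jla; rewrite /F /part_mult jla muln0 mul0r scale0r.
Qed.

Lemma partn_sum_unique w h : h 0 = 1 ->
  (forall k, k%:R * h k = \sum_(j < k) w j.+1 * h (k - j.+1)%N) ->
  h =1 partn_sum w.
Proof.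
move=> h0 hrec k; have [n] := ubnP k; elim: n k => // n IH [|k] kn.
  by rewrite h0 partn_sum0.
rewrite ltnS in kn.
(* The recurrence gives (k + 1) h_(k+1) from earlier values; the factor cancels because [A] is an
   algebra over a field of characteristic 0. *)
have inj : injective (fun a : A => k.+1%:R * a).
  apply: (can_inj (g := fun a => k.+1%:R^-1 *: a)) => a.
  by rewrite mulr_natl -scaler_nat scalerA mulVf ?scale1r // pnatr_eq0.
apply: inj; rewrite hrec partn_sum_rec; apply: eq_bigr => j _.
by rewrite IH // subSS; exact: leq_ltn_trans (leq_subr _ _) kn.
Qed.

End Exponential.

(** * Logarithmic derivatives of polynomials, by coefficients *)

Section LogDerivative.
Variable A : comNzRingType.
Implicit Types (w : nat -> A) (f g : {poly A}).

(* Coefficientwise form of X f' = (w 1 X + w 2 X^2 + ...) f; the value w 0 is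
   irrelevant. *)
Definition has_logderiv f w :=
  forall k, k%:R * f`_k = \sum_(j < k) w j.+1 * f`_(k - j.+1).

(** The logarithmic derivative is in general an infinite series; this truncation makes it a
    polynomial, exact for coefficients up to [N]. *)
Definition wpoly (N : nat) w : {poly A} :=
  \poly_(j < N.+1) (if j is 0 then 0 else w j).

Lemma coef_wpolyM N w f k : (k <= N)%N ->
  (wpoly N w * f)`_k = \sum_(j < k) w j.+1 * f`_(k - j.+1).
Proof.
move=> kN; rewrite coefM big_ord_recl coef_poly /= mul0r add0r.
apply: eq_bigr => j _; rewrite coef_poly /bump leq0n add1n ltnS.
by rewrite (leq_trans (ltn_ord j) kN).
Qed.

Lemma coef_Xderiv f k : ('X * f^`())`_k = k%:R * f`_k.
Proof.
by rewrite coefXM; case: k => [|k]; rewrite ?mul0r // coef_deriv mulr_natl.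
Qed.

Lemma has_logderivP f w : has_logderiv f w <->
  (forall N k, (k <= N)%N -> ('X * f^`())`_k = (wpoly N w * f)`_k).
Proof.
split=> [H N k kN|H k]; first by rewrite coef_Xderiv coef_wpolyM.
by rewrite -coef_Xderiv (H k) // coef_wpolyM.
Qed.

Lemma has_logderiv1 : has_logderiv 1 (fun=> 0).
Proof.
move=> k; rewrite big1 => [|j _]; last by rewrite mul0r.
by rewrite coef1; case: k => [|k]; rewrite ?mul0r ?mulr0.
Qed.

(** The Leibniz rule, applied modulo X^(N+1). *)
Lemma has_logderivM f g v w : has_logderiv f v -> has_logderiv g w ->
  has_logderiv (f * g) (fun j => v j + w j).
Proof.
move=> /has_logderivP fv /has_logderivP gw; apply/has_logderivP => N k kN.
have -> : wpoly N (fun j => v j + w j) = wpoly N v + wpoly N w.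
  apply/polyP => -[|j]; rewrite coefD !coef_poly ?addr0 //.
  by case: ifP; rewrite ?addr0.
(* The k-th coefficient of a product sees only coefficients of index at most k, so agreement up to k
   suffices. *)
have mulE (p q r : {poly A}) : (forall i, (i <= k)%N -> p`_i = q`_i) ->
    (p * r)`_k = (q * r)`_k.
  by move=> pq; rewrite !coefM; apply: eq_bigr => i _; rewrite pq ?leq_ord.
rewrite derivM mulrDr mulrDl !coefD !mulrA; congr (_ + _).
  by apply: mulE => i ik; rewrite (fv N) ?(leq_trans ik).
rewrite mulrAC [RHS](_ : _ = (wpoly N w * g * f)`_k); last by rewrite mulrAC.
by apply: mulE => i ik; rewrite (gw N) ?(leq_trans ik).
Qed.

Lemma has_logderiv_prod (I : Type) (r : seq I) (f : I -> {poly A})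
    (w : I -> nat -> A) :
  (forall i, has_logderiv (f i) (w i)) ->
  has_logderiv (\prod_(i <- r) f i) (fun j => \sum_(i <- r) w i j).
Proof.
move=> fw; elim: r => [|i r IH] k.
  by rewrite big_nil (has_logderiv1 k); apply: eq_bigr => j _; rewrite big_nil.
rewrite big_cons (has_logderivM (fw i) IH k).
by apply: eq_bigr => j _; rewrite big_cons.
Qed.

Definition bweight (b j : nat) : A := if (b %| j)%N then 1 - b%:R else 1.

(** In each block of b consecutive indices the weights are b - 1 ones followed by 1 - b, so the
    running sum returns to 0 at each multiple of b. *)
Lemma sum_bweight b k : (0 < b)%N ->
  \sum_(0 <= j < k) bweight b j.+1 = (k %% b)%:R.
Proof.
move=> b0; elim: k => [|k IH]; first by rewrite big_geq ?mod0n.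
rewrite big_nat_recr //= IH /bweight modnS; case: ifP => bk; last by rewrite -natr1.
(* When b divides k + 1, the residue of k is b - 1, so adding 1 - b gives 0. *)
rewrite addrA natr1 -[X in X%:R - _](_ : b = _) ?subrr //.
have : (k.+1 %% b = 0)%N by apply/eqP.
rewrite -addn1 -modnDml addn1 => h.
have := ltn_pmod k b0; rewrite leq_eqVlt => /orP[/eqP //|lt].
by rewrite modn_small in h.
Qed.

(* The coefficient of X^k on the right is x^k times the sum of the weights of
   index in (k - b, k]; the sum of the first k weights being k mod b, this window
   has sum k if k < b and 0 otherwise. *)
Lemma has_logderiv_geom b (x : A) : (0 < b)%N ->
  has_logderiv (\sum_(j < b) (x%:P * 'X) ^+ j) (fun j => bweight b j * x ^+ j).
Proof.
move=> b0 k.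
have fE i : (\sum_(j < b) (x%:P * 'X) ^+ j)`_i = if (i < b)%N then x ^+ i else 0.
  rewrite -(coef_poly b (fun j => x ^+ j)) poly_def; congr ((polyseq _)`_i).
  by apply: eq_bigr => j _; rewrite exprMn -rmorphXn mul_polyC.
rewrite fE.
transitivity (\sum_(k - b <= j < k) bweight b j.+1 * x ^+ k); last first.
  rewrite -(big_mkord predT (fun j => bweight b j.+1 * x ^+ j.+1 *
    (\sum_(j < b) (x%:P * 'X) ^+ j)`_(k - j.+1))).
  rewrite [RHS](big_cat_nat (n := (k - b)%N)) ?leq_subr //=.
  rewrite [X in _ = X + _]big_nat_cond [X in _ = X + _]big1.
    rewrite add0r big_nat_cond [RHS]big_nat_cond.
    apply: eq_bigr => j /andP[/andP[kj jk] _].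
    rewrite fE ltn_subLR // addSn ltnS addnC -leq_subLR kj.
    by rewrite -mulrA -exprD subnKC.
  (* For j < k - b the index k - j - 1 is at least b, beyond the degree of the factor. *)
  move=> j /andP[/andP[_ jk] _]; rewrite fE ltnNge leq_subRL.
    by rewrite addSn addnC -ltn_subRL jk /= mulr0.
  by rewrite (leq_trans jk) ?leq_subr.
rewrite -mulr_suml.
have := sum_bweight k b0; rewrite (big_cat_nat (n := (k - b)%N)) ?leq_subr //=.
rewrite sum_bweight // => /(canRL (addKr _)) ->.
(* If b <= k, then k - b and k have the same residue and the window sum vanishes. *)
case: ltnP => kb; last first.
  by rewrite -[in (k %% b)%N](subnK kb) modnDr addNr mulr0 mul0r.
have /eqP -> : (k - b == 0)%N by rewrite subn_eq0 ltnW.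
by rewrite mod0n oppr0 add0r modn_small.
Qed.

End LogDerivative.

(** * The partition formula and its specialization at 1 *)

Lemma prod_bweight (A : comNzRingType) b s :
  \prod_(i <- s) bweight A b i = (1 - b%:R) ^+ part_blength s b.
Proof.
elim: s => [|i s IH]; first by rewrite big_nil.
by rewrite big_cons IH /part_blength /= /bweight exprD; case: ifP; rewrite ?expr0.
Qed.

Lemma bsym_partn (K : numFieldType) b n k : (0 < b)%N ->
  bsym K b n k =
    \sum_(la : intpartn k)
      ((part_z la)%:R^-1 * (1 - b%:R) ^+ part_blength la b)
        *: psum_part K n la.
Proof.
move=> b0; pose w j : {mpoly K[n]} := bweight _ b j * psum K n j.
rewrite (_ : bsym K b n k = partn_sum w k).
  apply: eq_bigr => la _; rewrite big_split /= prod_bweight -scalerA.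
  congr (_ *: _); rewrite -mul_mpolyC rmorphXn rmorphB /= mpolyC1.
  by rewrite mpolyC_nat.
apply: (partn_sum_unique (h := bsym K b n)) => [|{}k].
  (* Each factor of the generating product has constant term 1. *)
  rewrite /bsym coef0_prod big1 // => i _; case: b b0 {w} => // b _.
  rewrite big_ord_recl expr0 coefD coef1 /= coef_sum big1 ?addr0 // => j _.
  by rewrite exprS -mulrA mulrCA coefXM.
(* Summing the weights c_j z_i^j of the factors over i gives c_j p_j. *)
have := has_logderiv_prod (index_enum 'I_n)
  (fun i => has_logderiv_geom ('X_i : {mpoly K[n]}) b0).
move=> ->; apply: eq_bigr => j _; congr (_ * _).
by rewrite /w /psum mulr_sumr.
Qed.

Lemma meval1_bsym (R : comNzRingType) b n k :
  (bsym R b n k).@[fun=> 1] = (bbinom b n k)%:~R.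
Proof.
(* Evaluation at 1 and the map from the integers act coefficientwise as ring morphisms, and both
   generating polynomials land on the same n-th power over [R]. *)
rewrite /bsym /bbinom -!coef_map /= rmorph_prod rmorphXn /=.
congr ((polyseq _)`_k); rewrite -[in RHS](card_ord n) -prodr_const.
apply: eq_bigr => i _; rewrite !rmorph_sum; apply: eq_bigr => j _ /=.
by rewrite !rmorphXn rmorphM /= map_polyC !map_polyX /= mevalXU mul1r.
Qed.

Lemma meval1_psum_part (R : comNzRingType) n s :
  (psum_part R n s).@[fun=> 1] = n%:R ^+ part_length s.
Proof.
rewrite /psum_part rmorph_prod /part_length -[RHS]/(n%:R ^+ size s).
elim: s => [|p s IH]; first by rewrite big_nil.
rewrite big_cons IH /= exprS; congr (_ * _).
rewrite /psum rmorph_sum /= -[in RHS](card_ord n) -sumr_const.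
by apply: eq_bigr => i _; rewrite rmorphXn /= mevalXU expr1n.
Qed.

Theorem proposition5p1 (b n k : nat) (hb : (2 <= b)%N) :
  [/\ bsym rat b n k =
        \sum_(la : intpartn k)
          ((part_z la)%:R^-1 * (1 - b%:R) ^+ part_blength la b)
            *: psum_part rat n la,
      (bsym rat b n k).@[fun=> 1] = (bbinom b n k)%:~R
    & (bbinom b n k)%:~R =
        \sum_(la : intpartn k)
          (part_z la)%:R^-1 * (1 - b%:R) ^+ part_blength la b
            * n%:R ^+ part_length la :> rat].
Proof.
have b0 : (0 < b)%N := ltnW hb.
split; [exact: bsym_partn | exact: meval1_bsym |].
(* The numerical identity is the image of the polynomial one under evaluation at 1. *)
rewrite -meval1_bsym bsym_partn // rmorph_sum; apply: eq_bigr => la _ /=.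
by rewrite mevalZ meval1_psum_part.
Qed.
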